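(* Let the pan be the planar disk of radius $R=15$, let $w=0.505$ (so a ring of radius $10$ has hole radius $9.495$), and consider the two inventories $$I_1=\{10,\,5,\,4.99,\,4.50\},\qquad I_2=\{10,\,5,\,4.76,\,4.74\}.$$ In $I_1$ the correct placement of the $5$ is the pan: best fit (which nests the $5$ in the hole of the $10$) fails to place the lex-max set, and worst fit (which puts the $5$ in the pan) places it. In $I_2$ the correct placement of the $5$ is the hole of the $10$: worst fit fails and best fit succeeds. When the $5$ is to be placed, the observable state is identical in $I_1$ and $I_2$. Consequently, no deterministic placement rule that is a function of the state attains the lex-max set on all instances, and for every randomized state-based placement rule some instance is failed with probability at least $1/2$.
   Context: Model. Fix a width $w>0$ and a pan, here a closed disk of radius $R$ in the plane. An inventory is a finite list of radii $r_1>r_2>\dots>r_n>0$; ring $i$ has outer radius $r_i$ and hole radius $\max(0,r_i-w)$. A placement of a set $S$ of rings is a forest: each ring of $S$ has as parent either the pan or another ring of $S$ with $r_{\mathrm{child}}\le r_{\mathrm{parent}}-w$, and the children of each common parent must be packable in the parent's region (the pan, or a disk of radius $r-w$ for the hole of a ring of radius $r$), i.e. closed disks having the children's outer radii can be positioned inside that region with pairwise disjoint interiors. Feasibility depends only on the parent assignment (siblings may be rearranged freely). $S$ is feasible if it has a placement. The lex-max set is obtained by scanning the rings in decreasing radius and including ring $i$ whenever the already included rings together with $i$ form a feasible set. A descending greedy processes the rings in decreasing radius; when ring $i$ is processed, a container (the pan or the hole of an already placed ring) admits it if the container's current children together with ring $i$ are packable in it; the ring receives some admitting container as its permanent parent,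 chosen by the placement rule, and is skipped only if no container admits it. Best fit chooses the admitting container of smallest capacity (radius), worst fit the one of largest capacity. An execution fails if it does not place exactly the lex-max set. The (observable) state at a step consists of the containers, their capacities, their current occupants, the incoming ring, $R$ and $w$ (not the rings still to come). A deterministic state-based rule is a function from states to admitting containers; a randomized state-based rule assigns to each state a probability distribution on admitting containers. *)

(* Defs.v *)
From HB Require Import structures.
From mathcomp Require Import all_boot all_order all_algebra.
From mathcomp Require Import boolp classical_sets reals topology normedtype.

Set Implicit Arguments.
Unset Strict Implicit.
Unset Printing Implicit Defensive.

Import Order.TTheory GRing.Theory Num.Theory.
Import numFieldNormedType.Exports.

Local Open Scope classical_set_scope.
Local Open Scope ring_scope.

(* The library's norm on [R * R] is the max norm, hence an explicit Euclidean
   distance; the product topology used by [interior] below is the usual one. *)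
Definition edist (R : realType) (p q : R * R) : R :=
  Num.sqrt ((p.1 - q.1) ^+ 2 + (p.2 - q.2) ^+ 2).

Definition disk (R : realType) (c : R * R) (r : R) : set (R * R) :=
  [set p | edist c p <= r].

Definition packable (R : realType) (rho : R) (s : seq R) : Prop :=
  exists c : 'I_(size s) -> R * R,
    (forall i, disk (c i) s`_i `<=` disk (0, 0) rho) /\
    (forall i j, i != j ->
       interior (disk (c i) s`_i) `&` interior (disk (c j) s`_j) = set0).

(* Rings of an inventory have distinct radii, so a ring is identified with its
   outer radius.  A container is [None], the pan, or [Some r], the hole of the
   ring of outer radius [r]. *)
Notation container R := (option R).

Definition capacity (R : realType) (rho w : R) (c : container R) : R :=
  if c is Some r then Num.max 0 (r - w) else rho.

Definition containers (R : realType) (S : seq R) : seq (container R) :=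
  None :: [seq Some r | r <- S].

(* Only the values of [par] on [S] matter.  When [0 < w], a parent ring is
   strictly larger than its child, so the parent assignment is a forest. *)
Definition placement (R : realType) (rho w : R) (S : seq R)
    (par : R -> container R) : Prop :=
  (forall r p, r \in S -> par r = Some p -> p \in S /\ r <= p - w) /\
  (forall c, c \in containers S ->
     packable (capacity rho w c) [seq r <- S | par r == c]).

Definition feasible (R : realType) (rho w : R) (S : seq R) : Prop :=
  exists par, placement rho w S par.

Record instance (R : realType) := Instance {
  pan_radius : R;
  width : R;
  inventory : seq R }.

Definition valid_instance (R : realType) (X : instance R) : Prop :=
  [/\ 0 < pan_radius X, 0 < width X,
      sorted >%R (inventory X) & all (fun r => 0 < r) (inventory X)].

Definition lexmax (R : realType) (X : instance R) : seq R :=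
  foldl (fun S r =>
           if `[< feasible (pan_radius X) (width X) (rcons S r) >]
           then rcons S r else S)
        [::] (inventory X).

(* What a rule sees of a container: the container, its capacity and its current
   occupants. *)
Notation cview R := (container R * R * seq R)%type.
Definition cv_container (R : realType) (v : cview R) : container R := v.1.1.
Definition cv_capacity (R : realType) (v : cview R) : R := v.1.2.
Definition cv_occupants (R : realType) (v : cview R) : seq R := v.2.

Record state (R : realType) := State {
  st_pan_radius : R;
  st_width : R;
  st_containers : seq (cview R);
  st_incoming : R }.

Definition admitting (R : realType) (s : state R) : seq (cview R) :=
  undup [seq v <- st_containers s |
    `[< packable (cv_capacity v) (rcons (cv_occupants v) (st_incoming s)) >]].

(* The rings placed so far, each with its parent, in order of placement; skipped
   rings leave no trace. *)
Notation config R := (seq (R * container R)).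

Definition observe (R : realType) (X : instance R) (P : config R) (r : R) :
    state R :=
  State (pan_radius X) (width X)
    [seq (c, capacity (pan_radius X) (width X) c,
          [seq x.1 | x <- P & x.2 == c])
    | c <- containers (unzip1 P)]
    r.

(* The value of a rule on a state without admitting container is irrelevant. *)
Definition det_rule (R : realType) (f : state R -> cview R) : Prop :=
  forall s, admitting s != [::] -> f s \in admitting s.

Definition rand_rule (R : realType) (mu : state R -> cview R -> R) : Prop :=
  forall s, admitting s != [::] ->
    [/\ forall v, 0 <= mu s v,
        forall v, v \notin admitting s -> mu s v = 0
      & \sum_(v <- admitting s) mu s v = 1].

(* No two admitting containers ever have the same capacity in a run, so the way
   [sort] breaks ties is irrelevant. *)
Definition best_fit (R : realType) (s : state R) : cview R :=
  head (None, 0, [::])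
    (sort (fun u v => cv_capacity u <= cv_capacity v) (admitting s)).

Definition worst_fit (R : realType) (s : state R) : cview R :=
  head (None, 0, [::])
    (sort (fun u v => cv_capacity v <= cv_capacity u) (admitting s)).

Definition run_on (R : realType) (X : instance R) (f : state R -> cview R)
    (s : seq R) : config R :=
  foldl (fun P r =>
           if admitting (observe X P r) == [::] then P
           else rcons P (r, cv_container (f (observe X P r))))
        [::] s.

Definition run (R : realType) (X : instance R) (f : state R -> cview R) :
    config R :=
  run_on X f (inventory X).

(* The state in which the ring of index [k] (from 0) is processed. *)
Definition state_at (R : realType) (X : instance R) (f : state R -> cview R)
    (k : nat) : state R :=
  observe X (run_on X f (take k (inventory X))) (inventory X)`_k.

Definition attained (R : realType) (X : instance R) (P : config R) : Prop :=
  unzip1 P =i lexmax X.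

(* Probability that the execution continued from [P] on the rings [s] ends in a
   configuration satisfying [E]. *)
Fixpoint exec_prob (R : realType) (X : instance R) (mu : state R -> cview R -> R)
    (E : config R -> Prop) (P : config R) (s : seq R) : R :=
  if s is r :: s' then
    if admitting (observe X P r) == [::] then exec_prob X mu E P s'
    else \sum_(v <- admitting (observe X P r))
           mu (observe X P r) v *
           exec_prob X mu E (rcons P (r, cv_container v)) s'
  else `[< E P >]%:R.

Definition fail_prob (R : realType) (X : instance R)
    (mu : state R -> cview R -> R) : R :=
  exec_prob X mu (fun P => ~ attained X P) [::] (inventory X).

(* The lex-max set has placements, and all of them give ring [r] the parent
   [c]. *)
Definition correct_parent (R : realType) (X : instance R) (r : R)
    (c : container R) : Prop :=
  [/\ r \in lexmax X,
      feasible (pan_radius X) (width X) (lexmax X)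
    & forall par, placement (pan_radius X) (width X) (lexmax X) par ->
        par r = c].

Definition I1 (R : realType) : instance R :=
  Instance 15 (505 / 1000) [:: 10; 5; 499 / 100; 450 / 100].

Definition I2 (R : realType) : instance R :=
  Instance 15 (505 / 1000) [:: 10; 5; 476 / 100; 474 / 100].

(* Main.v *)
Require Import Defs.
From mathcomp Require Import all_boot all_order all_algebra.
From mathcomp Require Import boolp classical_sets reals topology normedtype.
From mathcomp Require Import ring lra.

Set Implicit Arguments.
Unset Strict Implicit.
Unset Printing Implicit Defensive.

Import Order.TTheory GRing.Theory Num.Theory.
Import numFieldNormedType.Exports.
Local Open Scope ring_scope.

(** In both inventories every ring but the 10 fits in only two containers, the pan
    and the hole of the 10, for the radii other than 10 differ by less than [w].
    The 10 and the 5 fill a diameter of the pan, and what decides the fate of the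
    last two rings [b > c] is which of the two containers can hold both.

    In the hole, of radius 9.495, two disks fit exactly when the sum of their
    radii is at most 9.495 ([packable2]): 4.99 + 4.50 = 9.49 does and
    4.76 + 4.74 = 9.50 does not, while neither [b] nor [c] fits there with the 5.
    In the pan beside the 10, both fit if they are 4.76 and 4.74
    ([packable_10_476_474]), but no two disks of radii at least 4.99 and 4.50 do
    ([not_packable_triple]); this rules out 4.99 with 4.50, and also the 5 with
    any of the others.  Hence the 5 is forced into the pan for [I1]
    ([five_in_pan]) and into the hole for [I2] ([five_in_hole]).

    The link with executions is that an execution builds a placement of the rings
    it has placed ([outcome_realizes]).  If it places the whole inventory, then
    the inventory is feasible and is its own lex-max set ([run_complete]); so
    the runs [run_I1] and [run_I2] show both success and feasibility.  If it gives
    a ring a parent other than the correct one, it cannot attain the lex-max set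
    ([outcome_misplaced]), whatever happens afterwards.

    The 5 is processed in the same state, [crossroads], in both inventories, and
    in that state exactly the pan and the hole admit it.  A deterministic rule
    chooses one of them, and fails [I1] or [I2] accordingly.  A randomized rule
    fails [I1] at least with the probability of the hole and [I2] at least with
    that of the pan; these sum to 1, so one of them is at least 1/2. *)

(** * Disks and packings *)

(** The Euclidean distance of the model, as opposed to the extended distance of
    pseudometric spaces. *)
Local Notation edist := Defs.edist.

Section Disks.
Local Open Scope classical_set_scope.
Variable R : realType.
Implicit Types (p q c d : R * R) (r rho t : R).

Lemma edist_ge0 p q : 0 <= edist p q.
Proof. exact: sqrtr_ge0. Qed.

Lemma sqr_edist p q : edist p q ^+ 2 = (p.1 - q.1) ^+ 2 + (p.2 - q.2) ^+ 2.
Proof. by rewrite sqr_sqrtr // addr_ge0 ?sqr_ge0. Qed.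

Lemma edistC p q : edist p q = edist q p.
Proof. by rewrite /edist -(sqrrN (p.1 - _)) -(sqrrN (p.2 - _)) !opprB. Qed.

Lemma edist_leP p q r : 0 <= r ->
  (edist p q <= r) = ((p.1 - q.1) ^+ 2 + (p.2 - q.2) ^+ 2 <= r ^+ 2).
Proof. by move=> r0; rewrite -sqr_edist ler_sqr // nnegrE edist_ge0. Qed.

Lemma edist_geP p q r : 0 <= r ->
  (r <= edist p q) = (r ^+ 2 <= (p.1 - q.1) ^+ 2 + (p.2 - q.2) ^+ 2).
Proof. by move=> r0; rewrite -sqr_edist ler_sqr // nnegrE edist_ge0. Qed.

Lemma edist_triangle q p c : edist p c <= edist p q + edist q c.
Proof.
rewrite edist_leP ?addr_ge0 ?edist_ge0 // [leRHS]sqrrD !sqr_edist.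
have := edist_ge0 p q; have := edist_ge0 q c.
have := sqr_edist p q; have := sqr_edist q c.
move: (edist p q) (edist q c) => x y.
move: p q c => [p1 p2] [q1 q2] [r1 r2] /=.
move=> hy hx y0 x0.
have : `|(p1 - q1) * (q1 - r1) + (p2 - q2) * (q2 - r2)| <= x * y.
  rewrite -(@ler_sqr _ `|_|) ?nnegrE ?mulr_ge0 // real_normK ?num_real //.
  rewrite exprMn hx hy.
  have := sqr_ge0 ((p1 - q1) * (q2 - r2) - (p2 - q2) * (q1 - r1)); nra.
by move=> /(le_trans (ler_norm _)); nra.
Qed.

Lemma edist_line c d t :
  edist c (c.1 + t * (d.1 - c.1), c.2 + t * (d.2 - c.2)) = `|t| * edist c d.
Proof.
apply/eqP; rewrite -(@eqrXn2 _ 2) ?mulr_ge0 ?edist_ge0 //.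
rewrite exprMn !sqr_edist real_normK ?num_real //=; apply/eqP; ring.
Qed.

Lemma edist_line_end c d t :
  edist d (c.1 + t * (d.1 - c.1), c.2 + t * (d.2 - c.2)) =
  `|1 - t| * edist c d.
Proof.
apply/eqP; rewrite -(@eqrXn2 _ 2) ?mulr_ge0 ?edist_ge0 //.
rewrite exprMn !sqr_edist real_normK ?num_real //=; apply/eqP; ring.
Qed.

Lemma disk_subP c r rho : 0 <= r ->
  disk c r `<=` disk (0, 0) rho <-> edist c (0, 0) <= rho - r.
Proof.
move=> r0; split=> [sub|le p]; last first.
  rewrite /disk/= => pr.
  by have := edist_triangle c (0, 0) p; have := edistC c (0, 0); lra.
have [c0|cN0] := eqVneq (edist c (0, 0)) 0.
  have farE : edist c (c.1 + r, c.2) = r.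
    apply/eqP; rewrite -(@eqrXn2 _ 2) ?edist_ge0 // sqr_edist /=.
    by apply/eqP; ring.
  have := sub (c.1 + r, c.2); rewrite /disk/= farE => /(_ (lexx _)).
  have := edist_triangle (0, 0) c (c.1 + r, c.2).
  by rewrite c0 farE; lra.
have c_gt0 : 0 < edist c (0, 0) by rewrite lt_def cN0 edist_ge0.
(* the point of the disk farthest from the origin *)
pose t := - (r / edist c (0, 0)).
have tE : `|t| * edist c (0, 0) = r.
  by rewrite normrN ger0_norm ?divfK ?divr_ge0 ?edist_ge0.
have t0 : t <= 0 by rewrite oppr_le0 divr_ge0 // edist_ge0.
have := sub (c.1 + t * (0 - c.1), c.2 + t * (0 - c.2)).
rewrite /disk/= (edist_line c (0, 0)) (edist_line_end c (0, 0)) tE => /(_ (lexx _)).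
rewrite ger0_norm; last by lra.
by move: tE; rewrite ler0_norm // mulrBl mul1r mulNr; lra.
Qed.

(** A point at distance [r] of [c] is not interior: moving it slightly away from
    [c] leaves the disk. *)
Lemma interior_disk c r : 0 < r ->
  interior (disk c r) = [set p | edist c p < r].
Proof.
move=> r0; apply/seteqP; split=> p /=.
  move=> pint.
  have : \forall t \near (0 : R),
      disk c r (p.1 + t * (p.1 - c.1), p.2 + t * (p.2 - c.2)).
    have cv (a b : R) : a + t * b @[t --> (0 : R)] --> a + 0 * b.
      by apply: cvgD; [|apply: cvgM => //]; exact: cvg_cst.
    have := cvg_pair (cv p.1 (p.1 - c.1)) (cv p.2 (p.2 - c.2)).
    apply; rewrite !mul0r !addr0.
    by case: (p) pint.
  move=> /nbhs_ballP[e /= e0 be].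
  have := be (e / 2); rewrite /ball/= sub0r normrN gtr0_norm ?divr_gt0 //.
  have e2 : e / 2 < e by lra.
  move=> /(_ e2).
  have -> : (p.1 + e / 2 * (p.1 - c.1), p.2 + e / 2 * (p.2 - c.2)) =
     (c.1 + (1 + e / 2) * (p.1 - c.1), c.2 + (1 + e / 2) * (p.2 - c.2)).
    by congr pair; ring.
  rewrite /disk/= edist_line gtr0_norm; last by lra.
  have := edist_ge0 c p; nra.
have open_ball : open [set q | edist c q < r].
  have -> : [set q | edist c q < r] = (fun q : R * R =>
      (c.1 - q.1) ^+ 2 + (c.2 - q.2) ^+ 2) @^-1` [set x | x < r ^+ 2].
    apply/seteqP; split=> q /=;
      by rewrite -sqr_edist ltr_sqr // nnegrE ?edist_ge0 // ltW.
  apply: open_comp; last exact: open_lt.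
  have fst_cvg (q : R * R) : c.1 - p.1 @[p --> q] --> c.1 - q.1.
    by apply: cvgB; [exact: cvg_cst | exact: cvg_fst].
  have snd_cvg (q : R * R) : c.2 - p.2 @[p --> q] --> c.2 - q.2.
    by apply: cvgB; [exact: cvg_cst | exact: cvg_snd].
  move=> q _; apply: cvgD.
    exact: (cvgM (fst_cvg q) (fst_cvg q)).
  exact: (cvgM (snd_cvg q) (snd_cvg q)).
have : [set q | edist c q < r] `<=` disk c r by move=> q /ltW.
by rewrite (open_subsetE _ open_ball); apply.
Qed.

Lemma interior_disksP c d r rho : 0 < r -> 0 < rho ->
  interior (disk c r) `&` interior (disk d rho) = set0 <->
  r + rho <= edist c d.
Proof.
move=> r0 rho0; rewrite !interior_disk //; split=> [disj|le]; last first.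
  apply/seteqP; split=> // p [/= cp dp].
  by have := edist_triangle p c d; have := edistC d p; lra.
rewrite leNgt; apply/negP => lt.
(* the point dividing the segment from [c] to [d] in the ratio [r : rho] *)
pose t := r / (r + rho).
have s0 : 0 < r + rho by rewrite addr_gt0.
have t0 : 0 < t by rewrite divr_gt0.
have t1E : 1 - t = rho / (r + rho) by rewrite /t; field; lra.
have t1 : 0 < 1 - t by rewrite t1E divr_gt0.
suff : set0 (c.1 + t * (d.1 - c.1), c.2 + t * (d.2 - c.2)) by [].
rewrite -disj; split=> /=.
  rewrite edist_line gtr0_norm //.
  by rewrite /t mulrAC ltr_pdivrMr // ltr_pM2l.
rewrite edist_line_end gtr0_norm // t1E.
by rewrite mulrAC ltr_pdivrMr // ltr_pM2l.
Qed.
End Disks.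

Section Packings.
Variable R : realType.
Implicit Types (s : seq R) (a b r rho : R) (c : R -> R * R).

Definition packing rho s c : Prop :=
  {in s, forall a, edist (c a) (0, 0) <= rho - a} /\
  {in s &, forall a b, a != b -> a + b <= edist (c a) (c b)}.

(** Centers are indexed here by the radii themselves, so that passing to a subset
    of the radii, or reordering them, requires no reindexing.  With positive radii,
    containment and interior-disjointness become inequalities between distances
    of centers. *)
Lemma packableP rho s : uniq s -> {in s, forall a, 0 < a} ->
  packable rho s <-> exists c, packing rho s c.
Proof.
move=> us s_gt0.
have nth_gt0 (i : 'I_(size s)) : 0 < s`_i by apply/s_gt0/mem_nth.
split=> [[c [cin cdisj]]|[c [cin cdisj]]]; last first.
  exists (fun i => c s`_i); split=> [i|i j ij].
    by apply/disk_subP; [exact: ltW | apply/cin/mem_nth].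
  by apply/interior_disksP; rewrite ?cdisj ?mem_nth // nth_uniq.
pose c' a := odflt (0, 0) (omap c (insub (index a s))).
have c'E a : a \in s -> exists2 i : 'I_(size s), s`_i = a & c' a = c i.
  rewrite -index_mem => ai; exists (Ordinal ai).
    by rewrite /= nth_index // -index_mem.
  by rewrite /c' insubT.
exists c'; split=> [a /c'E[i <- ->]|a b /c'E[i <- ->] /c'E[j <- ->] ab].
  by apply/disk_subP; [exact: ltW | exact: cin].
apply/interior_disksP => //; apply: cdisj.
by apply: contra_neq ab => ->.
Qed.

Lemma packable_sub rho s s' : uniq s -> uniq s' -> {in s, forall a, 0 < a} ->
  {subset s' <= s} -> packable rho s -> packable rho s'.
Proof.
move=> us us' s_gt0 sub /(packableP _ us s_gt0)[c [cin cdisj]].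
apply/packableP => // [a /sub|]; first exact: s_gt0.
exists c; split=> [a /sub|a b /sub as_ /sub bs]; [exact: cin | exact: cdisj].
Qed.

Lemma packable_nil rho : packable rho [::].
Proof. by apply/packableP => //; exists (fun=> (0, 0)). Qed.

Lemma packable_le rho s a : uniq s -> {in s, forall a, 0 < a} ->
  packable rho s -> a \in s -> a <= rho.
Proof.
move=> us s_gt0 /(packableP _ us s_gt0)[c [+ _]] ains => /(_ _ ains).
by have := edist_ge0 (c a) (0, 0); lra.
Qed.

Lemma packable1 rho a : 0 < a -> packable rho [:: a] <-> a <= rho.
Proof.
move=> a0; have a_gt0 : {in [:: a], forall b, 0 < b} by move=> b /[!inE]/eqP->.
split=> [pk|le]; first by apply: (packable_le _ a_gt0 pk); rewrite ?mem_head.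
apply/packableP => //; exists (fun=> (0, 0)); split=> [b|b d]; rewrite !inE.
  by move=> /eqP ->; rewrite edist_leP //=; nra.
by move=> /eqP-> /eqP->; rewrite eqxx.
Qed.

(** Two disks of a packing are at distance at least [a + b], while their centers
    are within [rho - a] and [rho - b] of the center of the region. *)
Lemma packable_pair rho s a b : uniq s -> {in s, forall a, 0 < a} ->
  packable rho s -> a \in s -> b \in s -> a != b -> a + b <= rho.
Proof.
move=> us s_gt0 /(packableP _ us s_gt0)[c [cin cdisj]] ains bins ab.
have := cdisj _ _ ains bins ab; have := cin _ ains; have := cin _ bins.
have := edist_triangle (0, 0) (c a) (c b); have := edistC (c b) (0, 0).
lra.
Qed.

Lemma packable2 rho a b : 0 < a -> 0 < b -> a != b ->
  packable rho [:: a; b] <-> a + b <= rho.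
Proof.
move=> a0 b0 ab.
have ab_gt0 : {in [:: a; b], forall d, 0 < d}.
  by move=> d /[!inE]/orP[]/eqP->.
have uab : uniq [:: a; b] by rewrite /= inE ab.
split=> [pk|le].
  by apply: (packable_pair uab) => //; rewrite !inE eqxx ?orbT.
apply/packableP => //.
exists (fun d => if d == a then (a - rho, 0) else (rho - b, 0)).
have baF : (b == a) = false by rewrite eq_sym (negbTE ab).
split=> [d /[!inE]/orP[]/eqP->|d e /[!inE]/orP[]/eqP->/orP[]/eqP->];
  rewrite ?eqxx ?baF // => *.
- by rewrite edist_leP /=; nra.
- by rewrite edist_leP /=; nra.
- by rewrite edist_geP /=; nra.
- by rewrite edist_geP /=; nra.
Qed.

(** The second coordinates are bounded by what the first ones leave of the norms,
    too little for their product to cancel [xb * xc]. *)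
Lemma dot_lower_bound (xb yb xc yc : R) :
  4974 / 100 <= xb -> 375 / 10 <= xc ->
  xb ^+ 2 + yb ^+ 2 <= 5 ^+ 2 * (1001 / 100) ^+ 2 ->
  xc ^+ 2 + yc ^+ 2 <= 5 ^+ 2 * (105 / 10) ^+ 2 ->
  5 ^+ 2 * 61 < xb * xc + yb * yc.
Proof.
move=> hxb hxc hb hc.
have xbc : 1865 <= xb * xc.
  by apply: le_trans (ler_pM _ _ hxb hxc); lra.
have hyb : yb ^+ 2 <= 31 by clear xbc hxc hc; nra.
have hyc : yc ^+ 2 <= 1350 by clear xbc hxb hb hyb; nra.
have ybc : (yb * yc) ^+ 2 <= 205 ^+ 2.
  rewrite exprMn; apply: le_trans (ler_pM _ _ hyb hyc) _; rewrite ?sqr_ge0 //.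
  by clear; lra.
have : - 205 <= yb * yc.
  rewrite -real_normK ?num_real // ler_sqr ?nnegrE // in ybc.
  by have := ler_norm (- (yb * yc)); rewrite normrN; clear -ybc; lra.
clear -xbc; lra.
Qed.

(** [A], [B], [C] are the centers of disks of radii 10, 4.99 and 4.50 in a region
    of radius 15; the conclusion is that the last two overlap.  The constraints
    on [A], [B] and on [A], [C] force [B] and [C] to be nearly opposite to [A]:
    with [e] the direction of [-A], they give [e . B >= 9.948] and
    [e . C >= 7.5].  As [|B| <= 10.01] and [|C| <= 10.5], the components
    orthogonal to [e] are at most 1.12 and 7.35, so that [B . C] exceeds 66,
    whereas [|B - C| >= 9.49] requires it to be below 61.  To avoid dividing by
    [|A|], the components along [e] and across it are kept multiplied by it. *)
Lemma no_three_centers (A B C : R * R) :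
  edist A (0, 0) <= 5 -> edist B (0, 0) <= 1001 / 100 ->
  edist C (0, 0) <= 105 / 10 -> 1499 / 100 <= edist A B ->
  145 / 10 <= edist A C -> edist B C < 949 / 100.
Proof.
move: A B C => [A1 A2] [B1 B2] [C1 C2].
rewrite !edist_leP ?edist_geP ?divr_ge0 //= !subr0 => hA hB hC hAB hAC.
rewrite ltNge edist_geP ?divr_ge0 //=; apply/negP => hBC.
have hdot : B1 * C1 + B2 * C2 <= 61 by clear hA hAB hAC; lra.
have hXB : 4974 / 100 <= - (A1 * B1 + A2 * B2) by clear hC hAC hBC hdot; lra.
have hXC : 375 / 10 <= - (A1 * C1 + A2 * C2) by clear hB hAB hBC hdot hXB; lra.
have BE : (- (A1 * B1 + A2 * B2)) ^+ 2 + (A1 * B2 - A2 * B1) ^+ 2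
  = (A1 ^+ 2 + A2 ^+ 2) * (B1 ^+ 2 + B2 ^+ 2) by ring.
have CE : (- (A1 * C1 + A2 * C2)) ^+ 2 + (A1 * C2 - A2 * C1) ^+ 2
  = (A1 ^+ 2 + A2 ^+ 2) * (C1 ^+ 2 + C2 ^+ 2) by ring.
have sq_ge0 (x y : R) : 0 <= x ^+ 2 + y ^+ 2 by rewrite addr_ge0 ?sqr_ge0.
have := dot_lower_bound (yb := A1 * B2 - A2 * B1) (yc := A1 * C2 - A2 * C1)
  hXB hXC.
rewrite BE CE !ler_pM // => /(_ isT isT).
have -> : - (A1 * B1 + A2 * B2) * - (A1 * C1 + A2 * C2) +
   (A1 * B2 - A2 * B1) * (A1 * C2 - A2 * C1) =
   (A1 ^+ 2 + A2 ^+ 2) * (B1 * C1 + B2 * C2) by ring.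
apply/negP; rewrite -leNgt.
apply: le_trans (ler_wpM2l (sq_ge0 _ _) hdot) _.
by rewrite ler_wpM2r.
Qed.

(** Shrinking [b] to 4.99 and [c] to 4.50 only relaxes the constraints on the
    centers. *)
Lemma not_packable_triple s (b c : R) : uniq s -> {in s, forall a, 0 < a} ->
  10 \in s -> b \in s -> c \in s -> b != 10 -> c != 10 -> b != c ->
  499 / 100 <= b -> 450 / 100 <= c -> ~ packable 15 s.
Proof.
move=> us s_gt0 as_ bs cs b10 c10 bc hb hc /(packableP _ us s_gt0)[z [zin zdisj]].
have := zin _ as_; have := zin _ bs; have := zin _ cs => hC hB hA.
have := zdisj _ _ as_ bs; rewrite eq_sym b10 => /(_ isT) hAB.
have := zdisj _ _ as_ cs; rewrite eq_sym c10 => /(_ isT) hAC.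
have := zdisj _ _ bs cs bc.
suff : edist (z b) (z c) < 949 / 100 by clear -hb hc; lra.
by apply: (@no_three_centers (z 10)); clear -hb hc hA hB hC hAB hAC; lra.
Qed.

(** The three disks leave some slack in the pan, which allows centers with small
    rational coordinates. *)
Lemma packable_10_476_474 : packable (15 : R) [:: 10; 476 / 100; 474 / 100].
Proof.
have n1 : (476 / 100 == 10 :> R) = false by rewrite lt_eqF //; lra.
have n2 : (474 / 100 == 10 :> R) = false by rewrite lt_eqF //; lra.
have n3 : (474 / 100 == 476 / 100 :> R) = false by rewrite lt_eqF //; lra.
apply/packableP.
- by rewrite /= !inE ![10 == _]eq_sym ![476 / 100 == 474 / 100]eq_sym n1 n2 n3.
- by move=> a /[!inE]/or3P[]/eqP->; lra.
exists (fun a => if a == 10 then (- 5, 0) else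
  if a == 476 / 100 then (9, 48 / 10) else (9, - (475 / 100))).
split=> [a /[!inE]/or3P[]/eqP->|a b /[!inE]/or3P[]/eqP->/or3P[]/eqP->];
  rewrite ?eqxx ?n1 ?n2 ?n3 // => *;
  by rewrite ?edist_leP ?edist_geP /=; lra.
Qed.
End Packings.

(** * Placements, the lex-max set and executions *)

Section LexMax.
Variable R : realType.
Implicit Types (S s : seq R) (X : instance R) (r rho w : R).

Lemma gtr_trans : transitive (>%R : rel R).
Proof. by move=> y x z /= yx /lt_trans; apply. Qed.

Lemma gtr_sorted_uniq s : sorted >%R s -> uniq s.
Proof. by apply: sorted_uniq; [exact: gtr_trans | exact: ltxx]. Qed.

(** In a list sorted by decreasing radius every parent precedes its children, so
    a prefix contains the parents of its members. *)
Lemma placement_prefix rho w s1 s2 par : 0 < w -> sorted >%R (s1 ++ s2) ->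
  {in s1 ++ s2, forall a, 0 < a} ->
  placement rho w (s1 ++ s2) par -> placement rho w s1 par.
Proof.
move=> w0 srt pos [parE pk].
have us := gtr_sorted_uniq srt.
have in12 r : r \in s1 -> r \in s1 ++ s2 by rewrite mem_cat => ->.
have sub1 r p : r \in s1 -> par r = Some p -> p \in s1.
  move=> rs1 /(parE _ _ (in12 _ rs1))[+ rp]; rewrite mem_cat => /orP[//|ps2].
  move: srt; rewrite sorted_pairwise; last exact: gtr_trans.
  rewrite pairwise_cat => /and3P[/allrelP/(_ _ _ rs1 ps2)/= + _ _].
  lra.
split=> [r p rs1 rp|c cs].
  by split; [exact: sub1 rp | case: (parE _ _ (in12 _ rs1) rp)].
apply: packable_sub (pk c _).
- exact: filter_uniq.
- by apply: filter_uniq; move: us; rewrite cat_uniq => /and3P[].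
- by move=> a; rewrite mem_filter => /andP[_ /pos].
- by move=> a; rewrite !mem_filter => /andP[-> /in12].
- move: cs; rewrite !inE => /orP[->//|/mapP[p /in12 ps ->]].
  by rewrite map_f ?orbT.
Qed.

(** The scan never rejects a ring, as each list that it tests is a prefix of a
    feasible inventory. *)
Lemma lexmax_feasible X : valid_instance X ->
  feasible (pan_radius X) (width X) (inventory X) -> lexmax X = inventory X.
Proof.
move=> [_ w0 srt /allP pos] [par feas].
have fold_prefix s2 s1 : s1 ++ s2 = inventory X ->
    foldl (fun S r => if `[< feasible (pan_radius X) (width X) (rcons S r) >]
      then rcons S r else S) s1 s2 = inventory X.
  elim: s2 s1 => [|r s2 IH] s1 sE; first by rewrite -sE cats0.
  rewrite /= asboolT; first by apply: IH; rewrite cat_rcons.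
  exists par; apply: (@placement_prefix _ _ _ s2) => //; rewrite cat_rcons sE //.
exact: fold_prefix.
Qed.

Lemma lexmax_subseq X : subseq (lexmax X) (inventory X).
Proof.
rewrite /lexmax -[X in subseq _ X]cat0s; move: [::] (inventory X) => S s.
elim: s S => [|r s IH] S /=; first by rewrite cats0.
case: ifP => _; first by rewrite -cat_rcons.
apply: subseq_trans (IH S) _.
by rewrite cat_subseq // subseq_cons.
Qed.
End LexMax.

Section Executions.
Variable R : realType.
Implicit Types (X : instance R) (P Q : seq (R * option R)) (s : seq R) (r : R).
Implicit Types (c : option R) (f : state R -> cview R).

Definition occupants P c := [seq x.1 | x <- P & x.2 == c].

Definition admits X P r c := packable
  (capacity (pan_radius X) (width X) c) (rcons (occupants P c) r).

Definition view X P c : cview R :=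
  (c, capacity (pan_radius X) (width X) c, occupants P c).

Lemma occupants_subseq P c r :
  subseq (rcons (occupants P c) r) (rcons (unzip1 P) r).
Proof. by rewrite -!cats1 cat_subseq // map_subseq ?filter_subseq. Qed.

Lemma admits_le X P r c x : uniq (rcons (unzip1 P) r) ->
  {in rcons (unzip1 P) r, forall a, 0 < a} -> admits X P r c ->
  x \in rcons (occupants P c) r -> x <= capacity (pan_radius X) (width X) c.
Proof.
move=> uP pos adm; have sub := occupants_subseq P c r.
by apply: packable_le adm; [exact: subseq_uniq sub uP | move=> a /(mem_subseq sub)/pos].
Qed.

Lemma admits_hole X P r p : uniq (rcons (unzip1 P) r) ->
  {in rcons (unzip1 P) r, forall a, 0 < a} -> admits X P r (Some p) ->
  r <= p - width X.
Proof.
move=> uP pos /admits_le - /(_ r uP pos); rewrite mem_rcons mem_head => /(_ isT).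
have r0 : 0 < r by apply: pos; rewrite mem_rcons mem_head.
by rewrite /= le_max leNgt r0.
Qed.

Lemma admits_pair X P r c x : uniq (rcons (unzip1 P) r) ->
  {in rcons (unzip1 P) r, forall a, 0 < a} -> admits X P r c ->
  x \in occupants P c -> x + r <= capacity (pan_radius X) (width X) c.
Proof.
move=> uP pos adm xocc; have sub := occupants_subseq P c r.
have us := subseq_uniq sub uP.
apply: (packable_pair us _ adm) => [a /(mem_subseq sub)/pos //|||].
- by rewrite mem_rcons inE xocc orbT.
- by rewrite mem_rcons mem_head.
- by move: us; rewrite rcons_uniq => /andP[+ _]; apply: contraNneq => <-.
Qed.

Lemma view_inj X P : injective (view X P).
Proof. by move=> c c' []. Qed.

Lemma admittingE X P r : uniq (unzip1 P) -> admitting (observe X P r) =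
  [seq view X P c | c <- containers (unzip1 P) & `[< admits X P r c >]].
Proof.
move=> uP; rewrite /admitting.
have -> : st_containers (observe X P r) =
  [seq view X P c | c <- containers (unzip1 P)] by [].
rewrite filter_map undup_id // map_inj_uniq; last exact: view_inj.
apply: filter_uniq; rewrite /= map_inj_uniq ?uP ?andbT; last by move=> ? ? [].
by apply/mapP => -[].
Qed.

Lemma admittingP X P r v : v \in admitting (observe X P r) ->
  exists2 c, c \in containers (unzip1 P) & v = view X P c /\ admits X P r c.
Proof.
rewrite mem_undup mem_filter => /andP[/asboolP pk] /mapP[c cin vE].
by exists c => //; split=> //; move: pk; rewrite vE.
Qed.

(** The configurations which some choices of admitting containers lead to, the
    possible values of the random execution measured by [exec_prob]. *)
Fixpoint outcome X P s Q : Prop :=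
  if s is r :: s' then
    if admitting (observe X P r) == [::] then outcome X P s' Q
    else exists2 v, v \in admitting (observe X P r)
                  & outcome X (rcons P (r, cv_container v)) s' Q
  else Q = P.

Definition step X f P r :=
  if admitting (observe X P r) == [::] then P
  else rcons P (r, cv_container (f (observe X P r))).

Lemma outcome_run X f P s : det_rule f -> outcome X P s (foldl (step X f) P s).
Proof.
move=> fdet; elim: s P => //= r s IH P; rewrite [step _ _ P r]/step.
case: (boolP (admitting _ == [::])) => [_|/fdet fin]; first exact: IH.
by exists (f (observe X P r)).
Qed.

Lemma outcome_subset X P s Q : outcome X P s Q -> {subset P <= Q}.
Proof.
elim: s P => [P ->//|r s IH P] /=; case: ifP => _; first exact: IH.
by move=> [v _ /IH sub] x xP; apply: sub; rewrite mem_rcons inE xP orbT.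
Qed.

Definition realizes X P (par : R -> option R) : Prop :=
  placement (pan_radius X) (width X) (unzip1 P) par /\
  {in P, forall x, par x.1 = x.2}.

Lemma realizes_nil X : realizes X [::] (fun=> None).
Proof. by split=> //; split=> // c _; exact: packable_nil. Qed.

(** Only two containers need attention: [c], whose new contents have just been
    found packable, and the hole of [r], which no earlier ring can have as its
    parent. *)
Lemma realizes_rcons X P par r c : uniq (rcons (unzip1 P) r) ->
  {in rcons (unzip1 P) r, forall a, 0 < a} ->
  c \in containers (unzip1 P) -> admits X P r c -> realizes X P par ->
  exists par', realizes X (rcons P (r, c)) par'.
Proof.
move=> uP pos cin adm [[parE pk] agree].
have rNP : r \notin unzip1 P by move: uP; rewrite rcons_uniq => /andP[].
pose par' x := if x == r then c else par x.
have par'P x : x \in unzip1 P -> par' x = par x.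
  by rewrite /par' => xP; case: eqP xP rNP => [->->|].
have occE d : occupants P d = [seq x <- unzip1 P | par x == d].
  rewrite /occupants /unzip1 filter_map; congr map.
  by apply: eq_in_filter => x xP /=; rewrite agree.
exists par'; split; last first.
  move=> x; rewrite mem_rcons inE => /orP[/eqP->|xP]; first by rewrite /par' eqxx.
  by rewrite par'P ?agree //; exact: map_f.
rewrite /unzip1 map_rcons -/(unzip1 P); split=> [x p|d].
  rewrite mem_rcons inE => /orP[/eqP->|xP]; last first.
    rewrite par'P // => /(parE _ _ xP)[pP xp].
    by rewrite mem_rcons inE pP orbT.
  rewrite /par' eqxx => cE; move: cin; rewrite cE inE /= => /mapP[p' pP [pE]].
  rewrite -pE in pP; rewrite mem_rcons inE pP orbT; split=> //.
  by move: adm; rewrite cE; exact: admits_hole.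
rewrite filter_rcons {1}/par' eqxx.
have -> : [seq x <- unzip1 P | par' x == d] = occupants P d.
  by rewrite occE; apply: eq_in_filter => x /par'P ->.
case: eqP => [<-//|/eqP cd].
have [->|dr] := eqVneq d (Some r); last first.
  rewrite occE inE map_rcons mem_rcons inE (negbTE dr) /= => din; apply: pk.
  by rewrite inE.
suff -> : occupants P (Some r) = [::] by move=> _; exact: packable_nil.
rewrite occE; apply/eqP; rewrite -[_ == _]negbK -has_filter.
by apply: contra rNP => /hasP[x xP /eqP/(parE _ _ xP)[]].
Qed.

(** Keeping the rings [s] to come in the invariant ensures that an incoming ring
    is new and that the placed rings stay sorted. *)
Lemma outcome_realizes X P par s Q : valid_instance X ->
  subseq (unzip1 P ++ s) (inventory X) -> realizes X P par ->
  outcome X P s Q ->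
  subseq (unzip1 Q) (inventory X) /\ exists par', realizes X Q par'.
Proof.
move=> [_ _ srt /allP pos].
elim: s P par => [|r s IH] P par sub real /=.
  by move->; rewrite cats0 in sub; split=> //; exists par.
have skip : subseq (unzip1 P ++ s) (unzip1 P ++ r :: s).
  by rewrite cat_subseq // subseq_cons.
case: ifP => _; first exact: IH (subseq_trans skip sub) real.
move=> [v /admittingP[c cin [-> adm]] out].
have sub' : subseq (unzip1 (rcons P (r, c)) ++ s) (inventory X).
  by rewrite /unzip1 map_rcons cat_rcons.
have sub1 : subseq (rcons (unzip1 P) r) (inventory X).
  apply: subseq_trans (prefix_subseq _ s) _; by rewrite cat_rcons.
have [||par' real'] := realizes_rcons _ _ cin adm real.
- exact: subseq_uniq sub1 (gtr_sorted_uniq srt).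
- by move=> a /(mem_subseq sub1)/pos.
exact: IH real' out.
Qed.

Lemma outcome_from_empty X Q : valid_instance X ->
  outcome X [::] (inventory X) Q ->
  subseq (unzip1 Q) (inventory X) /\ exists par, realizes X Q par.
Proof.
by move=> valX; apply: outcome_realizes (realizes_nil X).
Qed.

(** A run that places every ring certifies the feasibility of the inventory, hence
    also that the lex-max set is the whole inventory. *)
Lemma run_complete X f : valid_instance X -> det_rule f ->
  unzip1 (run X f) = inventory X ->
  attained X (run X f) /\ lexmax X = inventory X /\
  feasible (pan_radius X) (width X) (lexmax X).
Proof.
move=> valX fdet runE; have out := outcome_run X [::] (inventory X) fdet.
have [_ [par [plc _]]] := outcome_from_empty valX out.
have feas : feasible (pan_radius X) (width X) (inventory X).
  by exists par; rewrite -runE.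
by rewrite /attained lexmax_feasible // runE.
Qed.

(** The parents chosen by an execution that attains the lex-max set form one of
    the placements of that set, and these all agree on [r]. *)
Lemma outcome_misplaced X Q r c c' : valid_instance X -> correct_parent X r c ->
  outcome X [::] (inventory X) Q -> (r, c') \in Q -> c' != c -> ~ attained X Q.
Proof.
move=> valX [_ _ parE] out rQ cc' att.
have [subQ [par [plc agree]]] := outcome_from_empty valX out.
have [_ _ srt _] := valX; have us := gtr_sorted_uniq srt.
suff QE : unzip1 Q = lexmax X.
  by move: plc cc'; rewrite QE => /parE <-; rewrite (agree _ rQ) eqxx.
move/(subseq_uniqP us): subQ => ->; move/(subseq_uniqP us): (lexmax_subseq X) => ->.
exact/eq_filter/att.
Qed.

Lemma exec_prob_ge0 X mu E P s : rand_rule mu -> 0 <= exec_prob X mu E P s.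
Proof.
move=> ruled; elim: s P => [|r s IH] P /=; first exact: ler0n.
case: ifPn => // /ruled[mu0 _ _].
by apply: sumr_ge0 => v _; rewrite mulr_ge0.
Qed.

Lemma exec_prob_sure X mu (E : seq (R * option R) -> Prop) P s : rand_rule mu ->
  (forall Q, outcome X P s Q -> E Q) -> exec_prob X mu E P s = 1.
Proof.
move=> ruled; elim: s P => [|r s IH] P /= sure.
  by rewrite asboolT //; exact: sure.
case: ifPn sure => [_|adm sure]; first exact: IH.
have [_ _ <-] := ruled _ adm; apply: eq_big_seq => v vin.
by rewrite IH ?mulr1 // => Q out; apply: sure; exists v.
Qed.
End Executions.

(** * The state in which the 5 is processed *)

Section Opening.
Variable R : realType.
Implicit Types (rest : seq R) (P Q : seq (R * option R)) (r : R).
Implicit Types (f : state R -> cview R) (v : cview R).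

(** Both inventories have this form. *)
Definition opening rest : instance R :=
  Instance 15 (505 / 1000) [:: 10, 5 & rest].

Definition after_ten : seq (R * option R) := [:: (10, None)].

(** A state does not show the rings to come, so this one is met with [opening rest]
    for every [rest]. *)
Definition crossroads : state R := observe (opening [::]) after_ten 5.
Definition pan_view : cview R := view (opening [::]) after_ten None.
Definition hole_view : cview R := view (opening [::]) after_ten (Some 10).

Lemma hole_capacity : capacity 15 (505 / 1000) (Some (10 : R)) = 9495 / 1000.
Proof. by rewrite /= max_r; lra. Qed.

Lemma admitting_ten rest : admitting (observe (opening rest) [::] 10) =
  [:: view (opening rest) [::] None].
Proof.
by rewrite admittingE //= asboolT // /admits /= packable1; lra.
Qed.

(** The 10 and the 5 fit side by side in the pan with no room to spare. *)
Lemma admitting_crossroads : admitting crossroads = [:: pan_view; hole_view].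
Proof.
have ten_neq5 : 10 != 5 :> R by rewrite gt_eqF //; lra.
rewrite admittingE //= !asboolT //.
  by rewrite /admits /occupants [capacity _ _ _]hole_capacity /= packable1; lra.
by rewrite /admits /= packable2 //; lra.
Qed.

Lemma step_forced X f P r c : det_rule f -> uniq (unzip1 P) ->
  c \in containers (unzip1 P) -> admits X P r c ->
  {in containers (unzip1 P), forall d, admits X P r d -> d = c} ->
  step X f P r = rcons P (r, c).
Proof.
move=> fdet uP cin adm only.
have admN : admitting (observe X P r) != [::].
  rewrite admittingE // -size_eq0 size_map size_filter -lt0n -has_count.
  by apply/hasP; exists c => //; exact/asboolP.
rewrite /step (negbTE admN).
by have /admittingP[d din [-> /(only _ din) ->]] := fdet _ admN.
Qed.

Lemma run_opening rest f : det_rule f -> run (opening rest) f =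
  foldl (step (opening rest) f) [:: (10, None); (5, cv_container (f crossroads))]
    rest.
Proof.
move=> fdet; rewrite /run /run_on /= admitting_ten /=.
have -> : cv_container (f (observe (opening rest) [::] 10)) = None.
  have := fdet (observe (opening rest) [::] 10).
  by rewrite admitting_ten inE => /(_ isT)/eqP->.
by rewrite -/crossroads -[observe _ _ 5]/crossroads admitting_crossroads.
Qed.

Lemma outcome_opening rest v Q : v \in [:: pan_view; hole_view] ->
  outcome (opening rest) [:: (10, None); (5, cv_container v)] rest Q ->
  outcome (opening rest) [::] (inventory (opening rest)) Q.
Proof.
move=> vin out; rewrite /= admitting_ten /=.
exists (view (opening rest) [::] None); first exact: mem_head.
by rewrite -[observe _ _ 5]/crossroads admitting_crossroads /=; exists v.
Qed.

(** The first step is forced, so the executions that choose [v] for the 5 have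
    total probability [mu crossroads v]. *)
Lemma fail_prob_opening rest mu v : rand_rule mu ->
  v \in [:: pan_view; hole_view] ->
  (forall Q, outcome (opening rest) [:: (10, None); (5, cv_container v)] rest Q ->
     ~ attained (opening rest) Q) ->
  mu crossroads v <= fail_prob (opening rest) mu.
Proof.
move=> ruled vin fails; rewrite /fail_prob /= admitting_ten /= big_seq1.
have tenN : admitting (observe (opening rest) [::] 10) != [::].
  by rewrite admitting_ten.
have [_ _] := ruled _ tenN; rewrite admitting_ten big_seq1 => ->; rewrite mul1r.
rewrite -[observe _ _ 5]/crossroads admitting_crossroads /=.
have crossN : admitting crossroads != [::] by rewrite admitting_crossroads.
have [mu0 _ _] := ruled _ crossN.
rewrite (bigD1_seq v vin) //=.
rewrite exec_prob_sure // mulr1 lerDl; apply: sumr_ge0 => u _.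
by rewrite mulr_ge0 ?exec_prob_ge0.
Qed.

Lemma det_rule_head_sort (le : cview R -> cview R -> bool) :
  det_rule (fun s : state R => head (None, 0, [::]) (sort le (admitting s))).
Proof.
move=> s; rewrite -(mem_sort le) -size_eq0 -(size_sort le).
by case: (sort _ _) => // v vs _; rewrite mem_head.
Qed.

Lemma best_fit_crossroads : best_fit crossroads = hole_view.
Proof.
rewrite /best_fit admitting_crossroads /sort /= /cv_capacity /=.
by rewrite -/(capacity 15 (505 / 1000) (Some (10 : R))) hole_capacity ifF //; lra.
Qed.

Lemma worst_fit_crossroads : worst_fit crossroads = pan_view.
Proof.
rewrite /worst_fit admitting_crossroads /sort /= /cv_capacity /=.
by rewrite -/(capacity 15 (505 / 1000) (Some (10 : R))) hole_capacity ifT //; lra.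
Qed.
End Opening.

(** * Inventories 10, 5, b, c *)

Section Inventories.
Variable R : realType.
Implicit Types (P : seq (R * option R)) (f : state R -> cview R) (r : R).

(** All rings but the 10 differ by less than [w], so they only fit in the pan or
    in the hole of the 10. *)
Section LastTwo.
Variables b c : R.
Hypotheses (c_ge : 450 / 100 <= c) (bc : c < b) (b_lt : b < 5).
Let X := opening [:: b; c].
Let S := inventory X.

Let srtS : sorted >%R S. Proof. by rewrite /=; move: c_ge bc b_lt; lra. Qed.

Let uS : uniq S. Proof. exact: gtr_sorted_uniq. Qed.

Let S_gt0 : {in S, forall a, 0 < a}.
Proof. by apply/allP => /=; move: c_ge bc b_lt; lra. Qed.

Let ten : 10 \in S. Proof. exact: mem_head. Qed.

Let neqs : [/\ (5 == 10 :> R) = false, (b == 10) = false, (c == 10) = false,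
  (b == 5) = false & (c == 5) = false].
Proof. by split; rewrite lt_eqF //; move: c_ge bc b_lt; lra. Qed.

Let narrow_hole p r : p \in S -> r \in S -> r <= p - width X -> p = 10 /\ r != 10.
Proof.
rewrite !inE => /or4P[]/eqP-> /or4P[]/eqP-> /=; move: c_ge bc b_lt; try lra;
  by split=> //; rewrite lt_eqF //; lra.
Qed.

Section Placements.
Variable par : R -> option R.
Hypothesis plc : placement (pan_radius X) (width X) S par.

Let par10 : par 10 = None.
Proof.
case E : (par 10) => [p|] //; have [pS /narrow_hole] := plc.1 _ _ ten E.
by move=> /(_ pS ten)[]; rewrite eqxx.
Qed.

Lemma pan_or_ten r : r \in S -> par r = None \/ par r = Some 10.
Proof.
move=> rS; case E : (par r) => [p|]; last by left.
have [pS /narrow_hole] := plc.1 _ _ rS E.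
by move=> /(_ pS rS)[-> _]; right.
Qed.

Let siblings_uniq d : uniq [seq r <- S | par r == d].
Proof. exact: filter_uniq. Qed.

Let siblings_gt0 d : {in [seq r <- S | par r == d], forall a, 0 < a}.
Proof. by move=> a; rewrite mem_filter => /andP[_ /S_gt0]. Qed.

Lemma ten_hole_pair x y : x \in S -> y \in S -> x != y ->
  par x = Some 10 -> par y = Some 10 -> x + y <= 9495 / 1000.
Proof.
move=> xS yS xy px py; rewrite -[leRHS]hole_capacity.
have cin : Some 10 \in containers S by rewrite inE map_f.
apply: packable_pair (plc.2 _ cin) _ _ xy => //.
  by rewrite mem_filter px eqxx.
by rewrite mem_filter py eqxx.
Qed.

Lemma pan_triple x y : x \in S -> y \in S -> x != y -> x != 10 -> y != 10 ->
  499 / 100 <= x -> par x = None -> par y = None -> False.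
Proof.
move=> xS yS xy x10 y10 hx px py.
have hy : 450 / 100 <= y.
  by move: yS; rewrite !inE => /or4P[]/eqP->; move: c_ge bc b_lt; lra.
apply: (not_packable_triple _ _ _ _ _ x10 y10 xy hx hy (plc.2 None _)) => //;
  by rewrite mem_filter ?px ?py ?par10 eqxx.
Qed.

Let five : 5 \in S. Proof. by rewrite !inE eqxx orbT. Qed.
Let b_in : b \in S. Proof. by rewrite !inE eqxx !orbT. Qed.
Let c_in : c \in S. Proof. by rewrite !inE eqxx !orbT. Qed.

(** If the 5 is in the hole, neither [b] nor [c] fits beside it, and the pan
    would have to hold both of them beside the 10. *)
Lemma five_in_pan : 499 / 100 <= b -> 9495 / 1000 < 5 + c -> par 5 = None.
Proof.
move=> hb lt; have [n5 nb nc nb5 nc5] := neqs.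
have [//|p5] := pan_or_ten five.
have not_hole x : x \in S -> x != 5 -> c <= x -> par x = None.
  move=> xS x5 cx; have [//|px] := pan_or_ten xS.
  by have le := ten_hole_pair xS five x5 px p5; exfalso; lra.
have cb : b != c by rewrite gt_eqF.
have pb : par b = None by rewrite not_hole ?nb5 // ltW.
have pc : par c = None by rewrite not_hole ?nc5.
by case: (pan_triple b_in c_in cb _ _ hb pb pc); rewrite ?nb ?nc.
Qed.

(** If the 5 is in the pan, neither [b] nor [c] fits beside it and the 10, and
    the hole would have to hold both of them. *)
Lemma five_in_hole : 9495 / 1000 < b + c -> par 5 = Some 10.
Proof.
move=> lt; have [n5 nb nc nb5 nc5] := neqs.
have [p5|//] := pan_or_ten five.
have five_ge : 499 / 100 <= 5 :> R by lra.
have not_pan x : x \in S -> x != 5 -> x != 10 -> par x = Some 10.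
  move=> xS x5 x10; have [px|//] := pan_or_ten xS.
  by case: (pan_triple five xS _ _ x10 five_ge p5 px); rewrite // ?n5 // eq_sym.
have cb : b != c by rewrite gt_eqF.
have pb : par b = Some 10 by rewrite not_pan ?nb ?nb5.
have pc : par c = Some 10 by rewrite not_pan ?nc ?nc5.
by have le := ten_hole_pair b_in c_in cb pb pc; exfalso; lra.
Qed.
End Placements.

(** A step at which only the pan and the hole of the 10 need to be examined. *)
Lemma step_opening f P r d : det_rule f -> subseq (rcons (unzip1 P) r) S ->
  d \in containers (unzip1 P) -> admits X P r d ->
  {in [:: None; Some 10], forall e, e != d -> ~ admits X P r e} ->
  step X f P r = rcons P (r, d).
Proof.
move=> fdet sub din adm only.
have uP := subseq_uniq sub uS.
have pos : {in rcons (unzip1 P) r, forall a, 0 < a}.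
  by move=> a /(mem_subseq sub)/S_gt0.
apply: step_forced => //; first by move: uP; rewrite rcons_uniq => /andP[].
move=> e ein adme; suff ein' : e \in [:: None; Some 10].
  by apply/eqP; apply: contraPT adme; exact: only.
case: e ein adme => [q|//]; rewrite !inE /= => /mapP[p pP [->]].
move=> /(admits_hole uP pos)/narrow_hole[||-> _]; last exact: eqxx.
  by apply: (mem_subseq sub); rewrite mem_rcons inE pP orbT.
by apply: (mem_subseq sub); rewrite mem_rcons mem_head.
Qed.

Lemma not_admits_pan_triple P r : subseq (rcons (unzip1 P) r) S ->
  (10, None) \in P -> (5, None) \in P -> r != 10 -> r != 5 -> 450 / 100 <= r ->
  ~ admits X P r None.
Proof.
move=> sub tenP fiveP r10 r5 hr.
have sub' := subseq_trans (occupants_subseq P None r) sub.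
have mem_occ x : (x, None) \in P -> x \in rcons (occupants P None) r.
  move=> xP; rewrite mem_rcons inE; apply/orP; right.
  by apply/mapP; exists (x, None); rewrite // mem_filter eqxx.
have five10 : 5 != 10 :> R by rewrite lt_eqF //; lra.
have five_ge : 499 / 100 <= 5 :> R by lra.
apply: (not_packable_triple _ _ (mem_occ _ tenP) (mem_occ _ fiveP) _ _ r10 _ _ hr).
- exact: subseq_uniq sub' uS.
- by move=> a /(mem_subseq sub')/S_gt0.
- by rewrite mem_rcons mem_head.
- by [].
- by rewrite eq_sym.
- by [].
Qed.

(** The 10 and the 5 close the pan to both [b] and [c], which the hole accepts. *)
Lemma run_from_pan f : b + c <= 9495 / 1000 -> det_rule f ->
  f (crossroads R) = pan_view R ->
  run X f = [:: (10, None); (5, None); (b, Some 10); (c, Some 10)].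
Proof.
move=> le fdet fpan; have [n5 nb nc nb5 nc5] := neqs.
rewrite run_opening // fpan /=.
rewrite (@step_opening _ _ b (Some 10)) //=; first last.
- move=> e /[!inE]/orP[]/eqP->; rewrite ?eqxx // => _.
  apply: not_admits_pan_triple; rewrite ?inE ?eqxx ?orbT ?nb ?nb5 //=.
    by rewrite !eqxx.
  by move: c_ge bc; lra.
- rewrite /admits /occupants [capacity _ _ _]hole_capacity /= packable1;
    by move: c_ge bc le; lra.
- by rewrite !inE eqxx.
- by rewrite !eqxx.
rewrite (@step_opening _ _ c (Some 10)) //=; first last.
- move=> e /[!inE]/orP[]/eqP->; rewrite ?eqxx // => _.
  apply: not_admits_pan_triple; rewrite ?inE ?eqxx ?orbT ?nc ?nc5 //=.
  by rewrite !eqxx.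
- rewrite /admits /occupants [capacity _ _ _]hole_capacity /= eqxx /= packable2;
    by rewrite ?gt_eqF //; move: c_ge bc le; lra.
- by rewrite !inE eqxx.
- by rewrite !eqxx.
Qed.

(** The 5 closes the hole to both [b] and [c], which the pan accepts. *)
Lemma run_from_hole f : 9495 / 1000 < 5 + c -> packable 15 [:: 10; b; c] ->
  det_rule f -> f (crossroads R) = hole_view R ->
  run X f = [:: (10, None); (5, Some 10); (b, None); (c, None)].
Proof.
move=> lt pk fdet fhole; have [n5 nb nc nb5 nc5] := neqs.
rewrite run_opening // fhole /=.
have not_hole P r : subseq (rcons (unzip1 P) r) S -> (5, Some 10) \in P ->
    c <= r -> ~ admits X P r (Some 10).
  move=> sub fiveP cr adm.
  have : 5 + r <= capacity 15 (505 / 1000) (Some 10).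
    apply: (admits_pair _ _ adm); first exact: subseq_uniq sub uS.
      by move=> a /(mem_subseq sub)/S_gt0.
    by apply/mapP; exists (5, Some 10); rewrite // mem_filter eqxx.
  by rewrite hole_capacity; move: lt cr; lra.
rewrite (@step_opening _ _ b None) //=; first last.
- move=> e /[!inE]/orP[]/eqP->; rewrite ?eqxx // => _.
  by apply: not_hole; rewrite ?inE ?eqxx ?orbT ?ltW //= !eqxx.
- by rewrite /admits /= packable2 ?(eq_sym 10) ?nb; move: c_ge bc b_lt; lra.
- by rewrite !eqxx.
rewrite (@step_opening _ _ c None) //=; first last.
- move=> e /[!inE]/orP[]/eqP->; rewrite ?eqxx // => _.
  by apply: not_hole; rewrite ?inE ?eqxx ?orbT //= !eqxx.
- by rewrite !eqxx.
Qed.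
End LastTwo.
End Inventories.

(** * The two inventories *)

Section TwoInventories.
Variable R : realType.
Implicit Types (f : state R -> cview R) (Q : seq (R * option R)).

Lemma valid_I1 : valid_instance (I1 R).
Proof. by split=> /=; lra. Qed.

Lemma valid_I2 : valid_instance (I2 R).
Proof. by split=> /=; lra. Qed.

Lemma run_I1 f : det_rule f -> f (crossroads R) = pan_view R ->
  run (I1 R) f =
  [:: (10, None); (5, None); (499 / 100, Some 10); (450 / 100, Some 10)].
Proof. by apply: run_from_pan; lra. Qed.

Lemma run_I2 f : det_rule f -> f (crossroads R) = hole_view R ->
  run (I2 R) f =
  [:: (10, None); (5, Some 10); (476 / 100, None); (474 / 100, None)].
Proof. by apply: run_from_hole; [lra..| exact: packable_10_476_474]. Qed.

Lemma correct_parent_I1 : correct_parent (I1 R) 5 None.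
Proof.
have [_ [lexE feas]] := run_complete valid_I1 (@det_rule_head_sort R _)
  (congr1 unzip1 (run_I1 (@det_rule_head_sort R _) (worst_fit_crossroads R))).
split=> //; first by rewrite lexE !inE eqxx orbT.
by rewrite lexE => par plc; apply: (five_in_pan _ _ _ plc); lra.
Qed.

Lemma correct_parent_I2 : correct_parent (I2 R) 5 (Some 10).
Proof.
have [_ [lexE feas]] := run_complete valid_I2 (@det_rule_head_sort R _)
  (congr1 unzip1 (run_I2 (@det_rule_head_sort R _) (best_fit_crossroads R))).
split=> //; first by rewrite lexE !inE eqxx orbT.
by rewrite lexE => par plc; apply: (five_in_hole _ _ _ plc); lra.
Qed.

Lemma fail_I1 Q : outcome (I1 R) [:: (10, None); (5, cv_container (hole_view R))]
    [:: 499 / 100; 450 / 100] Q -> ~ attained (I1 R) Q.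
Proof.
move=> out; have five : (5, Some 10) \in Q.
  by apply: (outcome_subset out); rewrite !inE eqxx orbT.
apply: outcome_misplaced valid_I1 correct_parent_I1 _ five _ => //.
by apply: outcome_opening out; rewrite !inE eqxx orbT.
Qed.

Lemma fail_I2 Q : outcome (I2 R) [:: (10, None); (5, cv_container (pan_view R))]
    [:: 476 / 100; 474 / 100] Q -> ~ attained (I2 R) Q.
Proof.
move=> out; have five : (5, None) \in Q.
  by apply: (outcome_subset out); rewrite !inE eqxx orbT.
apply: outcome_misplaced valid_I2 correct_parent_I2 _ five _ => //.
by apply: outcome_opening out; rewrite !inE eqxx.
Qed.

Lemma run_fails_I1 f : det_rule f -> f (crossroads R) = hole_view R ->
  (5, Some 10) \in run (I1 R) f /\ ~ attained (I1 R) (run (I1 R) f).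
Proof.
move=> fdet fhole; rewrite [run _ _]run_opening // fhole.
have out := outcome_run (I1 R) [:: (10, None); (5, Some 10)]
  [:: 499 / 100; 450 / 100] fdet.
split; last exact: fail_I1.
by apply: (outcome_subset out); rewrite !inE eqxx orbT.
Qed.

Lemma run_fails_I2 f : det_rule f -> f (crossroads R) = pan_view R ->
  ~ attained (I2 R) (run (I2 R) f).
Proof.
move=> fdet fpan; rewrite [run _ _]run_opening // fpan.
exact: fail_I2 (outcome_run (I2 R) _ _ fdet).
Qed.

Lemma det_rule_crossroads f : det_rule f ->
  f (crossroads R) = pan_view R \/ f (crossroads R) = hole_view R.
Proof.
move=> fdet; have := fdet (crossroads R); rewrite admitting_crossroads => /(_ isT).
by rewrite !inE => /orP[]/eqP; [left | right].
Qed.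

Lemma state_at_five rest f : det_rule f ->
  state_at (opening rest) f 1 = crossroads R.
Proof.
move=> fdet; rewrite /state_at /run_on /= admitting_ten /=.
have := fdet (observe (opening rest) [::] 10).
by rewrite admitting_ten inE => /(_ isT)/eqP->.
Qed.
End TwoInventories.

Theorem theorem14 (R : realType) :
  (valid_instance (I1 R) /\ valid_instance (I2 R) /\
   capacity 15 (505 / 1000) (Some (10 : R)) = 9495 / 1000) /\
  (correct_parent (I1 R) 5 None /\
   (5, Some 10) \in run (I1 R) (@best_fit R) /\
   ~ attained (I1 R) (run (I1 R) (@best_fit R)) /\
   (5, None) \in run (I1 R) (@worst_fit R) /\
   attained (I1 R) (run (I1 R) (@worst_fit R))) /\
  (correct_parent (I2 R) 5 (Some 10) /\
   ~ attained (I2 R) (run (I2 R) (@worst_fit R)) /\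
   attained (I2 R) (run (I2 R) (@best_fit R))) /\
  (forall f g : state R -> cview R, det_rule f -> det_rule g ->
     state_at (I1 R) f 1 = state_at (I2 R) g 1) /\
  (~ exists2 f : state R -> cview R, det_rule f &
       forall X : instance R, valid_instance X -> attained X (run X f)) /\
  (forall mu : state R -> cview R -> R, rand_rule mu ->
     exists2 X : instance R, valid_instance X & 1 / 2 <= fail_prob X mu).
Proof.
have best_det : det_rule (@best_fit R) by exact: det_rule_head_sort.
have worst_det : det_rule (@worst_fit R) by exact: det_rule_head_sort.
have bestE := best_fit_crossroads R; have worstE := worst_fit_crossroads R.
have valid1 := valid_I1 R; have valid2 := valid_I2 R.
have [fail1 fail1'] := run_fails_I1 best_det bestE.
have [win1 _] := run_complete valid1 worst_det (congr1 unzip1 (run_I1 worst_det worstE)).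
have [win2 _] := run_complete valid2 best_det (congr1 unzip1 (run_I2 best_det bestE)).
have five_pan : (5, None) \in run (I1 R) (@worst_fit R).
  by rewrite (run_I1 worst_det worstE) in_cons mem_head orbT.
have lose2 := run_fails_I2 worst_det worstE.
split; first exact: (conj valid1 (conj valid2 (hole_capacity R))).
split.
  split; first exact: correct_parent_I1.
  exact: (conj fail1 (conj fail1' (conj five_pan win1))).
split; first exact: (conj (correct_parent_I2 R) (conj lose2 win2)).
split; first by move=> f g fdet gdet; rewrite !state_at_five.
split=> [[f fdet wins]|mu ruled].
  have [fpan|fhole] := det_rule_crossroads fdet.
    exact: run_fails_I2 fdet fpan (wins _ valid2).
  have [_] := run_fails_I1 fdet fhole; apply; exact: wins.
have sum1 : mu (crossroads R) (pan_view R) + mu (crossroads R) (hole_view R) = 1.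
  have crossN : admitting (crossroads R) != [::] by rewrite admitting_crossroads.
  have [_ _] := ruled _ crossN.
  by rewrite admitting_crossroads big_cons big_seq1.
have [le|lt] := lerP (1 / 2) (mu (crossroads R) (hole_view R)).
  exists (I1 R); first exact: valid1.
  apply: le_trans le _; apply: fail_prob_opening (@fail_I1 R); first exact: ruled.
  by rewrite in_cons mem_head orbT.
exists (I2 R); first exact: valid2.
apply: (@le_trans _ _ (mu (crossroads R) (pan_view R))); first by lra.
by apply: fail_prob_opening (@fail_I2 R); [exact: ruled | exact: mem_head].
Qed.
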